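(* Let $(C_n)_{n}$ be a family of Boolean circuits (fan-in at most two $\land,\lor$ gates and $\neg$ gates) such that $C_n$ computes $\mathrm{CLIQUE}$ on $n$-vertex graphs, $C_n$ has depth $d=d(n)$, and every gate of $C_n$ computes a Boolean function (of the inputs of $C_n$) having an orientation of weight at most $w=w(n)$, where $w>0$. Then $d\cdot w=\Omega(n)$.
   Context: A Boolean function $f:\{0,1\}^N\to\{0,1\}$ has orientation $\beta\in\{0,1\}^N$ if there is a monotone $h:\{0,1\}^{2N}\to\{0,1\}$ with $f(x)=h(x,x\oplus\beta)$ for all $x$; the weight of $\beta$ is its number of ones. $\mathrm{CLIQUE}$ denotes $\mathrm{CLIQUE}(n,n/2)$: the function on $\binom{n}{2}$ variables (the edges of an $n$-vertex undirected graph) that is $1$ iff the graph has a clique of size $n/2$. The depth of a circuit is the length of the longest root-to-leaf path. *)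

(* Defs.v *)
From mathcomp Require Import all_boot all_order all_algebra.

Set Implicit Arguments.
Unset Strict Implicit.
Unset Printing Implicit Defensive.

Section BooleanFunctions.
Variable V : finType.
Implicit Types (x y beta : {ffun V -> bool}) (f : {ffun V -> bool} -> bool).

Definition monotone f := forall x y, (forall v, x v ==> y v) -> f x ==> f y.

Definition xorv x beta : {ffun V -> bool} := [ffun v => x v (+) beta v].

Definition weight beta := #|[set v | beta v]|.

End BooleanFunctions.

Section Orientation.
Variable V : finType.

(* {0,1}^(2N) is represented by the assignments to the N + N variables V + V. *)
Definition catv (x y : {ffun V -> bool}) : {ffun V + V -> bool} :=
  [ffun i => match i with inl v => x v | inr v => y v end].

Definition has_orientation (f : {ffun V -> bool} -> bool)
    (beta : {ffun V -> bool}) :=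
  exists h : {ffun V + V -> bool} -> bool,
    monotone h /\ forall x, f x = h (catv x (xorv x beta)).

End Orientation.

(* A circuit is a DAG whose gates are listed in topological order. A wire     *)
(* [inl v] is the input variable v, and [inr j] is the output of gate j. A    *)
(* fan-in 0 gate is a constant: GAnd [::] is true and GOr [::] is false.      *)
Section Circuits.
Variable V : finType.

Definition wire : Type := V + nat.

Variant gate := GAnd of seq wire | GOr of seq wire | GNot of wire.

Definition fanin (g : gate) : seq wire :=
  match g with GAnd us | GOr us => us | GNot u => [:: u] end.

Definition wire_before (k : nat) (u : wire) : bool :=
  if u is inr j then j < k else true.

Definition gate_at (gs : seq gate) (k : nat) : gate := nth (GAnd [::]) gs k.

Definition wf_circuit (gs : seq gate) (out : wire) : bool :=
  [forall k : 'I_(size gs), (size (fanin (gate_at gs k)) <= 2)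
                            && all (wire_before k) (fanin (gate_at gs k))]
  && wire_before (size gs) out.

Record circuit := Circuit {
  gates : seq gate;
  output : wire;
  _ : wf_circuit gates output
}.

Definition wire_val (x : {ffun V -> bool}) (vs : seq bool) (u : wire) : bool :=
  match u with inl v => x v | inr j => nth false vs j end.

Definition gate_val (x : {ffun V -> bool}) (vs : seq bool) (g : gate) : bool :=
  match g with
  | GAnd us => all (wire_val x vs) us
  | GOr us => has (wire_val x vs) us
  | GNot u => ~~ wire_val x vs u
  end.

Definition gate_vals (x : {ffun V -> bool}) (gs : seq gate) : seq bool :=
  foldl (fun vs g => rcons vs (gate_val x vs g)) [::] gs.

Definition gate_fun (c : circuit) (k : nat) (x : {ffun V -> bool}) : bool :=
  nth false (gate_vals x (gates c)) k.

Definition circuit_fun (c : circuit) (x : {ffun V -> bool}) : bool :=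
  wire_val x (gate_vals x (gates c)) (output c).

Definition children (c : circuit) (u : wire) : seq wire :=
  if u is inr j then fanin (gate_at (gates c) j) else [::].

(* [path_to_leaf c u l]: some path of l edges leads from u to a leaf. *)
Inductive path_to_leaf (c : circuit) : wire -> nat -> Prop :=
| path_leaf u : children c u = [::] -> path_to_leaf c u 0
| path_step u u' l :
    u' \in children c u -> path_to_leaf c u' l -> path_to_leaf c u l.+1.

Definition has_depth (c : circuit) (d : nat) : Prop :=
  path_to_leaf c (output c) d /\
  forall l, path_to_leaf c (output c) l -> l <= d.

End Circuits.

Definition edge (n : nat) : finType := {e : {set 'I_n} | #|e| == 2}.

Lemma card_edge n : #|edge n| = 'C(n, 2).
Proof.
rewrite card_sig -[in RHS](card_ord n) -card_draws.
by apply: eq_card => e; rewrite !inE.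
Qed.

Definition CLIQUE (n k : nat) (x : {ffun edge n -> bool}) : bool :=
  [exists S : {set 'I_n}, (#|S| == k) &&
    [forall e : edge n, (val e \subset S) ==> x e]].

Arguments CLIQUE : clear implicits.

(* Main.v *)
Require Import Defs.
From mathcomp Require Import all_boot all_order all_fingroup all_algebra.
From mathcomp Require Import zify ring lra.

(** Walking down the circuit, two players holding a 1-input [x] and a 0-input
    [y] of CLIQUE find an edge with [x e = 1] and [y e = 0]: before entering the
    children of a gate they compare [x] and [y] on the at most [2 w] variables
    in which the children may be non-monotone, and Alice raises [x] to [y]
    there. This costs [O(w)] bits per level, and no NOT gate is ever entered.

    Such a protocol with [L] leaves needs [L] exponential in [n]. Embed bit
    vectors [x], [y] of length [m = Theta(n)] into a clique and a complete
    multipartite graph so that the answers are one planted edge and one edge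
    per common 1 of [x] and [y]. Under a random relabelling of the vertices
    these [1 + |x /\ y|] answers are indistinguishable, so the planted one is
    returned with probability exactly [1 / (1 + |x /\ y|)]. Pair this matrix
    with the [m]-th tensor power of [[1, 2], [2, -1]], which is [5^(m/2)] times
    an orthogonal matrix: each leaf contributes at most [5^(m/2) 2^m], but the
    total is [int_0^1 (5 - s)^m ds], of order [5^m / m]. *)

Set Implicit Arguments.
Unset Strict Implicit.
Unset Printing Implicit Defensive.

Import Order.TTheory GRing.Theory Num.Theory.

(** * Protocols from circuits *)

Section Protocols.
Variables A B O : Type.

Inductive protocol :=
| Answer of O
| AskA of (A -> bool) & protocol & protocol
| AskB of (B -> bool) & protocol & protocol.

Fixpoint run (t : protocol) (x : A) (y : B) : O :=
  match t with
  | Answer o => o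
  | AskA p t1 t2 => if p x then run t1 x y else run t2 x y
  | AskB q t1 t2 => if q y then run t1 x y else run t2 x y
  end.

Fixpoint leaves (t : protocol) : nat :=
  match t with
  | Answer _ => 1
  | AskA _ t1 t2 | AskB _ t1 t2 => leaves t1 + leaves t2
  end.

Lemma leaves_gt0 t : 0 < leaves t.
Proof. by elim: t => //= _ t1 H1 t2 H2; rewrite addn_gt0 H1. Qed.

Fixpoint premapA (f : A -> A) (t : protocol) : protocol :=
  match t with
  | Answer o => Answer o
  | AskA p t1 t2 => AskA (p \o f) (premapA f t1) (premapA f t2)
  | AskB q t1 t2 => AskB q (premapA f t1) (premapA f t2)
  end.

Lemma run_premapA f t x y : run (premapA f t) x y = run t (f x) y.
Proof. by elim: t => //= [p|q] t1 -> t2 ->. Qed.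

Lemma leaves_premapA f t : leaves (premapA f t) = leaves t.
Proof. by elim: t => //= [p|q] t1 -> t2 ->. Qed.

End Protocols.

(** * Karchmer-Wigderson games restricted to inputs agreeing on a set *)

Section KarchmerWigderson.
Variable V : finType.
Local Notation input := {ffun V -> bool}.
Local Notation kw := (protocol input input V).
Implicit Types (x y : input) (f : input -> bool) (B R : {set V}) (t : kw).

Definition monotone_off B f := forall x y,
  (forall v, x v ==> y v) -> {in B, x =1 y} -> f x -> f y.

(** Agreement on [B] guarantees that an answer exists when [f] is monotone off [B]. *)
Definition solves t B f := forall x y, {in B, x =1 y} -> f x -> ~~ f y ->
  x (run t x y) && ~~ y (run t x y).

(** On the support of [beta], [x] and [y] agree, so both halves fed to [h] agree there; elsewhere
    the second half repeats the first. *)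
Lemma orientation_monotone_off f beta :
  has_orientation f beta -> monotone_off [set v | beta v] f.
Proof.
case=> h [h_mono fE] x y le_xy eq_xy; rewrite !fE; apply/implyP/h_mono.
case=> v; rewrite !ffunE // .
case: (boolP (beta v)) => bv; last by rewrite !addbF.
by rewrite (eq_xy v) ?inE // implybb.
Qed.

(** Alice speaks only where Bob has a 0, and her 1 there ends the game. The continuation receives
    the set of Bob's ones. *)
Fixpoint compare (rs : seq V) (k : {set V} -> kw) : kw :=
  if rs is v :: rs' then
    AskB (fun y => y v) (compare rs' (fun S => k (v |: S)))
      (AskA (fun x => x v) (Answer _ _ v) (compare rs' k))
  else k set0.

(** Each variable gives two copies of the rest and one leaf, a factor of at most 3; using 4 keeps
    the bounds powers of 2. *)
Lemma leaves_compare rs k L :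
  (forall S, leaves (k S) <= L) -> leaves (compare rs k) <= 4 ^ size rs * L.
Proof.
elim: rs k => [|v rs IH] k kL /=; first by rewrite expn0 mul1n.
have L_gt0 : 0 < L by apply: leq_trans (kL set0); apply: leaves_gt0.
have := IH _ (fun S => kL (v |: S)); have := IH _ kL.
have : 0 < 4 ^ size rs by rewrite expn_gt0.
rewrite expnS; nia.
Qed.

Lemma run_compare rs k x y (o := run (compare rs k) x y) :
  x o && ~~ y o \/
  {in rs, forall v, x v ==> y v} /\ o = run (k [set v in rs | y v]) x y.
Proof.
rewrite {}/o; elim: rs k => [|v rs IH] k /=.
  by right; split=> //; congr (run (k _) x y); apply/setP=> u; rewrite !inE.
case: ifP => yv.
  have [->|[le_xy ->]] := IH (fun S => k (v |: S)); [by left|right; split].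
    by move=> u; rewrite inE => /predU1P[->|/le_xy//]; rewrite yv implybT.
  congr (run (k _) x y); apply/setP=> u; rewrite !inE.
  by case: eqP => //= ->.
case: ifP => xv; first by left; rewrite xv yv.
have [->|[le_xy ->]] := IH k; [by left|right; split].
  by move=> u; rewrite inE => /predU1P[->|/le_xy//]; rewrite xv.
congr (run (k _) x y); apply/setP=> u; rewrite !inE.
by case: eqP => //= ->; rewrite yv andbF.
Qed.

Definition overwrite R (S : {set V}) x : input :=
  [ffun v => if v \in R then v \in S else x v].

(* The players compare their inputs on [R]. If no answer shows up there, Alice
   raises her input to Bob's on [R]; this keeps [f x] as [f] is monotone off
   [B], and creates no new answer. *)
Lemma solves_refine t B R f : monotone_off B f -> solves t (B :|: R) f ->
  exists2 t', leaves t' <= 4 ^ #|R| * leaves t & solves t' B f.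
Proof.
move=> f_mono t_ok.
exists (compare (enum R) (fun S => premapA (overwrite R S) t)).
  by rewrite cardE; apply: leaves_compare => S; rewrite leaves_premapA.
move=> x y eq_xy fx fy.
have [//|[le_xy ->]] :=
  run_compare (enum R) (fun S => premapA (overwrite R S) t) x y.
rewrite run_premapA; set S := [set v in _ | _].
pose x' := overwrite R S x.
have x'R v : v \in R -> x' v = y v.
  by move=> vR; rewrite ffunE vR !inE mem_enum vR.
have x'nR v : v \notin R -> x' v = x v by move=> vR; rewrite ffunE (negbTE vR).
have le_xx' v : x v ==> x' v.
  have [vR|vR] := boolP (v \in R); last by rewrite x'nR ?implybb.
  by rewrite x'R // le_xy // mem_enum.
have eq_x'y : {in B :|: R, x' =1 y}.
  move=> v; rewrite inE; have [/x'R->//|vR] := boolP (v \in R).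
  by rewrite orbF x'nR //; apply: eq_xy.
have fx' : f x'.
  apply: f_mono fx => // v vB.
  by rewrite eq_x'y ?inE ?vB // eq_xy.
have := t_ok _ _ eq_x'y fx' fy; rewrite -/x'.
set o := run t x' y; case/andP=> x'o yo; rewrite yo andbT.
have [oR|oR] := boolP (o \in R); last by rewrite -x'nR.
by rewrite x'R // (negbTE yo) in x'o.
Qed.

(** One bit from Bob names a conjunct that is false at his input; for a disjunction, Alice names a
    true one. *)
Lemma solves_and t1 t2 B1 B2 f1 f2 : solves t1 B1 f1 -> solves t2 B2 f2 ->
  solves (AskB f1 t2 t1) (B1 :|: B2) (fun x => f1 x && f2 x).
Proof.
move=> ok1 ok2 x y eq_xy /andP[f1x f2x] /=.
by case: ifP => /= f1y fy; [apply: ok2|apply: ok1] => //;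
  rewrite ?f1y // => v vB; apply: eq_xy; rewrite inE vB ?orbT.
Qed.

Lemma solves_or t1 t2 B1 B2 f1 f2 : solves t1 B1 f1 -> solves t2 B2 f2 ->
  solves (AskA f1 t1 t2) (B1 :|: B2) (fun x => f1 x || f2 x).
Proof.
move=> ok1 ok2 x y eq_xy fx; rewrite negb_or => /andP[f1y f2y] /=.
by case: ifP fx => /= f1x fx; [apply: ok1|apply: ok2] => //;
   move=> v vB; apply: eq_xy; rewrite inE vB ?orbT.
Qed.

(* If both [f] and its negation are monotone off a set on which [x] and [y]
   agree, then [f] takes the same value at [x], [y] and their join. *)
Lemma solves_not t B B1 f : monotone_off B (fun x => ~~ f x) ->
  monotone_off B1 f -> solves t (B :|: B1) (fun x => ~~ f x).
Proof.
move=> nf_mono f_mono x y eq_xy nfx; rewrite negbK => fy.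
pose z : input := [ffun v => x v || y v].
have eq_xz v : v \in B :|: B1 -> z v = x v /\ z v = y v.
  by move=> /eq_xy eq_v; rewrite ffunE eq_v orbb.
suff: ~~ f z.
  case/negP; apply: f_mono fy => v; first by rewrite ffunE; case: (y v); rewrite ?orbT.
  by move=> vB; rewrite (eq_xz v _).2 // inE vB orbT.
apply: nf_mono nfx => v; first by rewrite ffunE; case: (x v).
by move=> vB; rewrite (eq_xz v _).1 // inE vB.
Qed.

End KarchmerWigderson.

(** * Walking down a circuit *)

Section CircuitProtocol.
Variables (V : finType) (c : circuit V).
Local Notation input := {ffun V -> bool}.
Implicit Types (x : input) (u : wire V) (gs : seq (gate V)).

Definition wire_fun u x := wire_val x (gate_vals x (gates c)) u.

Lemma gate_vals_rcons x gs g :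
  gate_vals x (rcons gs g) = rcons (gate_vals x gs) (gate_val x (gate_vals x gs) g).
Proof. by rewrite /gate_vals -cats1 foldl_cat. Qed.

Lemma size_gate_vals x gs : size (gate_vals x gs) = size gs.
Proof.
by elim/last_ind: gs => // gs g IH; rewrite gate_vals_rcons !size_rcons IH.
Qed.

Lemma eq_gate_val x vs vs' g :
  {in fanin g, wire_val x vs =1 wire_val x vs'} -> gate_val x vs g = gate_val x vs' g.
Proof.
case: g => [us|us|u] eq_vs /=; [exact: eq_in_all|exact: eq_in_has|].
by rewrite eq_vs ?inE.
Qed.

(** Wires point backwards, so appending gates never alters the values that a gate reads. *)
Lemma nth_gate_vals x gs k : k < size gs ->
  (forall j, j < size gs -> all (wire_before j) (fanin (gate_at gs j))) ->
  nth false (gate_vals x gs) k = gate_val x (gate_vals x gs) (gate_at gs k).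
Proof.
elim/last_ind: gs k => // gs g IH k.
rewrite size_rcons => lt_k wf_gs.
have wf_j j : j < size gs -> all (wire_before j) (fanin (gate_at gs j)).
  by move=> lt_j; have := wf_gs j (ltnW lt_j); rewrite /gate_at nth_rcons lt_j.
have eq_val h : all (wire_before (size gs)) (fanin h) ->
    gate_val x (gate_vals x (rcons gs g)) h = gate_val x (gate_vals x gs) h.
  move=> /allP wf_h; apply: eq_gate_val => -[v|j] //= /wf_h /= lt_j.
  by rewrite gate_vals_rcons nth_rcons size_gate_vals lt_j.
have before_le j us : j <= size gs -> all (@wire_before V j) us ->
    all (wire_before (size gs)) us.
  by move=> le_j; apply: sub_all => -[v|i] //= /leq_trans; apply.
rewrite eq_val; last by apply: before_le (wf_gs k lt_k).
rewrite gate_vals_rcons nth_rcons size_gate_vals /gate_at nth_rcons.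
have [lt_k'|] := ltnP k (size gs); first exact: IH.
by move=> le_k; have -> : k == size gs by rewrite eqn_leq le_k -ltnS lt_k.
Qed.

Lemma circuit_wf : wf_circuit (gates c) (output c).
Proof. by case: c. Qed.

Lemma fanin_wf k : k < size (gates c) ->
  size (fanin (gate_at (gates c) k)) <= 2 /\
  all (wire_before k) (fanin (gate_at (gates c) k)).
Proof.
move=> lt_k; have /andP[/forallP wf_c _] := circuit_wf.
by have /andP := wf_c (Ordinal lt_k).
Qed.

Lemma gate_funE k x : k < size (gates c) ->
  wire_fun (inr k) x = gate_val x (gate_vals x (gates c)) (gate_at (gates c) k).
Proof.
by move=> lt_k; apply: nth_gate_vals => // j /fanin_wf[].
Qed.

(** Depth bounds only paths that end in a leaf; this turns a child into such a path. *)
Lemma path_to_leaf_exists u : wire_before (size (gates c)) u ->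
  exists l, path_to_leaf c u l.
Proof.
case: u => [v _|k]; first by exists 0; apply: path_leaf.
elim/ltn_ind: k => k IH /= lt_k.
case fanE: (fanin (gate_at (gates c) k)) => [|u us].
  by exists 0; apply: path_leaf.
have uk : u \in children c (inr k) by rewrite /= fanE mem_head.
have [_ /allP/(_ u uk) u_before] := fanin_wf lt_k.
suff [l ul] : exists l, path_to_leaf c u l.
  by exists l.+1; apply: path_step uk ul.
case: {fanE uk}u u_before => [v _|j /= lt_j]; first by exists 0; apply: path_leaf.
by apply: IH => //; apply: ltn_trans lt_k.
Qed.

Variables (v0 : V) (w : nat).
Hypothesis w_gt0 : 0 < w.
Hypothesis c_orient : forall k, k < size (gates c) ->
  exists beta : input, has_orientation (gate_fun c k) beta /\ weight beta <= w.

Lemma wire_monotone_off u : wire_before (size (gates c)) u ->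
  exists2 B : {set V}, #|B| <= w & monotone_off B (wire_fun u).
Proof.
case: u => [v _|k /= lt_k].
  exists set0; first by rewrite cards0.
  by move=> x y le_xy _; apply/implyP/le_xy.
have [beta [/orientation_monotone_off f_mono le_w]] := c_orient lt_k.
by exists [set v | beta v].
Qed.

(** Induction on the depth bound. A level costs 4^(2w) for comparing on the children's sets and 2
    for choosing a child, at most 2^(5w) since [w] is positive. *)
Lemma circuit_protocol D u (B : {set V}) : wire_before (size (gates c)) u ->
  (forall l, path_to_leaf c u l -> l <= D) -> monotone_off B (wire_fun u) ->
  exists2 t, leaves t <= 2 ^ (5 * w * D) & solves t B (wire_fun u).
Proof.
elim: D u B => [|D IH] [v|k] B /= lt_k leD f_mono;
  [by exists (Answer _ _ v); [rewrite expn_gt0|move=> x y _ /= -> ->] | |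
   by exists (Answer _ _ v); [rewrite expn_gt0|move=> x y _ /= -> ->] |];
  have fE x := gate_funE x lt_k;
  have [size_fan /allP wf_fan] := fanin_wf lt_k;
  have {}wf_fan u : u \in children c (inr k) -> wire_before (size (gates c)) u
    by move/wf_fan; case: (u) => //= j lt_j; apply: ltn_trans lt_k.
(* Depth 0 forces an empty fan-in: the gate is constant, the game has no instance, and [v0] is a
   dummy answer. *)
- have fan_nil u : u \notin children c (inr k).
    apply/negP=> uk; have [l ul] := path_to_leaf_exists (wf_fan u uk).
    by have := leD _ (path_step uk ul).
  exists (Answer _ _ v0); first by rewrite expn_gt0.
  move=> x y _; rewrite !fE; move: fan_nil; rewrite /children.
  case: gate_at => [[|u us]|[|u us]|u] //=; by move/(_ u); rewrite mem_head.
pose good u := exists (B1 : {set V}) t1, [/\ #|B1| <= w, monotone_off B1 (wire_fun u),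
  leaves t1 <= 2 ^ (5 * w * D) & solves t1 B1 (wire_fun u)].
have fan_good u : u \in children c (inr k) -> good u.
  move=> uk; have [B1 le_w mono1] := wire_monotone_off (wf_fan u uk).
  have [l /(path_step uk)/leD leDl|t1 le_t1 ok1] := IH u B1 (wf_fan u uk) _ mono1.
    by [].
  by exists B1, t1.
have refine (R : {set V}) t : #|R| <= 2 * w -> leaves t <= 2 * 2 ^ (5 * w * D) ->
    solves t (B :|: R) (wire_fun (inr k)) ->
    exists2 t', leaves t' <= 2 ^ (5 * w * D.+1) & solves t' B (wire_fun (inr k)).
  move=> le_R le_t ok_t; have [t' le_t' ok_t'] := solves_refine f_mono ok_t.
  exists t' => //; apply: leq_trans le_t' _.
  apply: (@leq_trans (4 ^ (2 * w) * (2 * 2 ^ (5 * w * D)))).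
    by rewrite leq_mul // leq_exp2l.
  rewrite -[4]/(2 ^ 2) -expnM -expnS -expnD leq_exp2l //; lia.
have eq_solves (f : input -> bool) t R : (forall x, wire_fun (inr k) x = f x) ->
    solves t R f -> solves t (B :|: R) (wire_fun (inr k)).
  move=> eq_f ok_t x y eq_xy; rewrite !eq_f; apply: ok_t => v vR.
  by apply: eq_xy; rewrite inE vR orbT.
have and_step u1 u2 : good u1 -> good u2 ->
    (forall x, wire_fun (inr k) x = wire_fun u1 x && wire_fun u2 x) ->
    exists2 t', leaves t' <= 2 ^ (5 * w * D.+1) & solves t' B (wire_fun (inr k)).
  move=> [B1 [t1 [le1 _ le_t1 ok1]]] [B2 [t2 [le2 _ le_t2 ok2]]] eq_f.
  apply: (refine (B1 :|: B2) (AskB (wire_fun u1) t2 t1)); last first.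
  - by apply: eq_solves eq_f _; apply: solves_and.
  - by rewrite /= mul2n -addnn leq_add.
  - by apply: leq_trans (leq_card_setU _ _) _; rewrite mul2n -addnn leq_add.
have or_step u1 u2 : good u1 -> good u2 ->
    (forall x, wire_fun (inr k) x = wire_fun u1 x || wire_fun u2 x) ->
    exists2 t', leaves t' <= 2 ^ (5 * w * D.+1) & solves t' B (wire_fun (inr k)).
  move=> [B1 [t1 [le1 _ le_t1 ok1]]] [B2 [t2 [le2 _ le_t2 ok2]]] eq_f.
  apply: (refine (B1 :|: B2) (AskA (wire_fun u1) t1 t2)); last first.
  - by apply: eq_solves eq_f _; apply: solves_or.
  - by rewrite /= mul2n -addnn leq_add.
  - by apply: leq_trans (leq_card_setU _ _) _; rewrite mul2n -addnn leq_add.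
move: fan_good size_fan fE; rewrite /children.
case: gate_at => [[|u1 [|u2 [|u3 us]]]|[|u1 [|u2 [|u3 us]]]|u] // fan_good _ fE.
- exists (Answer _ _ v0); first by rewrite expn_gt0.
  by move=> x y _; rewrite !fE.
(* Fan-in one is handled as two equal inputs. *)
- by apply: (and_step u1 u1) => [||x];
    [apply: fan_good; rewrite !inE eqxx ?orbT //..|rewrite fE /= andbT andbb].
- by apply: (and_step u1 u2) => [||x];
    [apply: fan_good; rewrite !inE eqxx ?orbT //..|rewrite fE /= andbT].
- exists (Answer _ _ v0); first by rewrite expn_gt0.
  by move=> x y _; rewrite !fE.
- by apply: (or_step u1 u1) => [||x];
    [apply: fan_good; rewrite !inE eqxx ?orbT //..|rewrite fE /= orbF orbb].
- by apply: (or_step u1 u2) => [||x];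
    [apply: fan_good; rewrite !inE eqxx ?orbT //..|rewrite fE /= orbF].
(* The NOT gate is monotone off [B] and its input off [B1], so agreement on both sets leaves no
   instance and any answer serves. *)
have [B1 [_ [le1 mono1 _ _]]] : good u by apply: fan_good; rewrite inE.
apply: (refine B1 (Answer _ _ v0)).
- by rewrite mul2n -addnn -[#|B1|]addn0 leq_add.
- by rewrite muln_gt0 expn_gt0.
have nf_mono : monotone_off B (fun x => ~~ wire_fun u x).
  by move=> x y le_xy eq_xy; have := f_mono _ _ le_xy eq_xy; rewrite !fE.
move=> x y; rewrite !fE. 
exact: (@solves_not _ (Answer _ _ v0) _ _ _ nf_mono mono1 x y).
Qed.

End CircuitProtocol.

(** * The orthogonal tensor power *)

Section SignMatrix.
Local Open Scope ring_scope.
Variable m : nat.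
Local Notation bits := {ffun 'I_m -> bool}.
Implicit Types (x y : bits).

Definition wt (b c : bool) : rat :=
  if b && c then -1 else if b || c then 2 else 1.

(* The m-th tensor power of [[1, 2], [2, -1]], which is sqrt 5 times an
   orthogonal matrix. *)
Definition W x y : rat := \prod_i wt (x i) (y i).

Definition common x y : nat := #|[set i | x i && y i]|.

Lemma card_bits : #|{: bits}| = (2 ^ m)%N.
Proof. by rewrite card_ffun card_bool card_ord. Qed.

Lemma W_orthogonal y y' :
  \sum_x W x y * W x y' = if y == y' then 5 ^+ m else 0.
Proof.
under eq_bigr do rewrite -big_split /=.
rewrite -(bigA_distr_bigA (fun i b => wt b (y i) * wt b (y' i))).
have sum_wt c c' : \sum_b wt b c * wt b c' = if c == c' then 5 else 0.
  by rewrite big_bool; case: c c' => [] [] /=; rewrite /wt /=; lra.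
under eq_bigr do rewrite sum_wt.
case: eqP => [<-|/eqP neq_y].
  by under eq_bigr do rewrite eqxx; rewrite prodr_const card_ord.
have [i yi] : exists i, y i != y' i.
  apply/existsP; apply: contra_neqT neq_y; rewrite negb_exists => /forallP eq_y.
  by apply/ffunP=> i; apply/eqP; have := eq_y i; rewrite negbK.
by rewrite (bigD1 i) //= (negbTE yi) mul0r.
Qed.

(** Lindsey's lemma: orthogonality gives the row sums over [B] the square norm 5^m |B|. Evenness of
    [m] makes the root of 5^m rational. *)
Lemma W_rectangle h (A B : {set bits}) : m = h.*2 ->
  \sum_(x in A) \sum_(y in B) W x y <= 20 ^+ h.
Proof.
move=> mE; pose g x := \sum_(y in B) W x y.
have g_norm : \sum_x g x ^+ 2 = 5 ^+ m * #|B|%:R.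
  transitivity (\sum_(y in B) \sum_(y' in B) \sum_x W x y * W x y').
    under eq_bigr do rewrite expr2 mulr_suml.
    rewrite exchange_big; apply: eq_bigr => y yB.
    under eq_bigr do rewrite mulr_sumr.
    by rewrite exchange_big.
  rewrite -mulr_natr -sumr_const mulr_sumr; apply: eq_bigr => y yB.
  under eq_bigr do rewrite W_orthogonal.
  rewrite (bigD1 y) //= eqxx big1 ?addr0 ?mulr1 // => y' /andP[_ /negbTE].
  by rewrite eq_sym => ->.
have card_le (D : {set bits}) : #|D|%:R <= 4 ^+ h :> rat.
  by rewrite -natrX ler_nat -[4%N]/(2 ^ 2)%N -expnM mul2n -mE -card_bits max_card.
have e25 : 5 ^+ m = 5 ^+ h * 5 ^+ h :> rat by rewrite mE -addnn exprD.
have p5 : 0 < 5 ^+ h :> rat by rewrite exprn_gt0.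
have p4 : 0 < 4 ^+ h :> rat by rewrite exprn_gt0.
(* Cauchy-Schwarz in the form 2 a g <= a^2 + g^2 with a = 5^h, which avoids square roots. *)
rewrite -(@ler_pM2l _ (2 * 5 ^+ h)) ?mulr_gt0 //.
apply: (@le_trans _ _ (\sum_(x in A) (5 ^+ h * 5 ^+ h + g x ^+ 2))).
  rewrite mulr_sumr; apply: ler_sum => x _; rewrite -/(g x).
  by move: (5 ^+ h) (g x) => a b; have := sqr_ge0 (a - b); nra.
rewrite big_split /= sumr_const -[X in X + _]mulr_natr.
have : \sum_(x in A) g x ^+ 2 <= \sum_x g x ^+ 2.
  by rewrite [X in _ <= X](bigID (mem A)) /= lerDl sumr_ge0 // => x _; rewrite sqr_ge0.
have -> : 20 ^+ h = 4 ^+ h * 5 ^+ h :> rat.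
  by rewrite -exprMn; congr (_ ^+ _); lra.
rewrite g_norm e25 => le_g.
have := card_le A; have := card_le B.
move: p5 p4 le_g; move: (5 ^+ h) (4 ^+ h) #|A|%:R #|B|%:R (\sum_(x in A) _).
move=> a b cA cB s a_gt0 b_gt0 le_s le_B le_A.
have a2 : 0 < a * a by rewrite mulr_gt0.
have : a * a * cA <= a * a * b by rewrite ler_pM2l.
have : a * a * cB <= a * a * b by rewrite ler_pM2l.
lra.
Qed.

(** Since 1/(r+1) is the integral of s^r over [0, 1], it suffices to integrate the generating
    polynomial, which factors over the coordinates: each contributes 1 + 2 + 2 - s. *)
Lemma sum_W_common : \sum_x \sum_y W x y / (common x y).+1%:R =
  (5 ^+ m.+1 - 4 ^+ m.+1) / m.+1%:R.
Proof.
(* [I p] is the integral of [p] over [0, 1]. *)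
pose I (p : {poly rat}) := \sum_(i < m.+1) p`_i / i.+1%:R.
have I_monom (a : rat) r : (r <= m)%N -> I (a *: 'X^r) = a / r.+1%:R.
  move=> le_r; rewrite /I (bigD1 (Ordinal (le_r : (r < m.+1)%N))) //=.
  rewrite coefZ coefXn eqxx mulr1.
  rewrite big1 ?addr0 // => i ne_i; rewrite coefZ coefXn.
  by rewrite -val_eqE /= in ne_i; rewrite (negbTE ne_i) mulr0 mul0r.
have I_sum (T : finType) (F : T -> {poly rat}) : I (\sum_t F t) = \sum_t I (F t).
  by rewrite /I exchange_big; apply: eq_bigr => i _; rewrite coef_sum mulr_suml.
have common_le x y : (common x y <= m)%N.
  by have := max_card (mem [set i | x i && y i]); rewrite card_ord.
have genfun : \sum_x \sum_y W x y *: 'X^(common x y) = (5%:P - 'X) ^+ m.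
  pose F b c : {poly rat} := wt b c *: 'X^(b && c).
  transitivity (\sum_(x : bits) \sum_(y : bits) \prod_i F (x i) (y i)).
    apply: eq_bigr => x _; apply: eq_bigr => y _.
    rewrite scaler_prod; congr (_ *: _).
    rewrite prodrXr /common -sum1_card big_mkcond /=; congr ('X ^+ _).
    by apply: eq_bigr => i _; rewrite inE; case: andb.
  under eq_bigr do rewrite -(bigA_distr_bigA (fun i c => F (_ i) c)).
  rewrite -(bigA_distr_bigA (fun i b => \sum_c F b c)) prodr_const card_ord.
  rewrite !big_bool /F /wt /= expr0 expr1 -!mul_polyC !mulr1; congr (_ ^+ _).
  by rewrite polyCN polyC1; ring.
have -> : \sum_x \sum_y W x y / (common x y).+1%:R = I ((5%:P - 'X) ^+ m).
  rewrite -genfun I_sum; apply: eq_bigr => x _.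
  by rewrite I_sum; apply: eq_bigr => y _; rewrite I_monom.
rewrite exprBn I_sum.
have m_neq0 : m.+1%:R != 0 :> rat by rewrite pnatr_eq0.
apply: (mulIf m_neq0); rewrite mulfVK // mulr_suml.
(* Expanding 4 as 5 - 1 cancels 5^(m+1) and matches the remaining terms one by one. *)
have -> : 4 ^+ m.+1 = (5 - 1) ^+ m.+1 :> rat by congr (_ ^+ _); lra.
rewrite exprBn [in RHS]big_ord_recl /= subn0 bin0 !expr0 mulr1n !mulr1 !mul1r.
rewrite opprD addrA subrr sub0r -sumrN; apply: eq_bigr => i _.
rewrite /bump /= add1n subSS expr1n mulr1.
have monomE (a : rat) (r q : nat) :
    (-1) ^+ i * a%:P ^+ r * 'X^i *+ q = ((-1) ^+ i * a ^+ r *+ q) *: 'X^i.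
  by rewrite -mul_polyC polyCMn polyCM !polyC_exp polyCN polyC1 mulrnAl.
rewrite monomE I_monom; last by rewrite -ltnS.
have binE : 'C(m, i)%:R / i.+1%:R * m.+1%:R = 'C(m.+1, i.+1)%:R :> rat.
  have i_neq0 : i.+1%:R != 0 :> rat by rewrite pnatr_eq0.
  apply: (mulIf i_neq0); rewrite mulrAC mulfVK // -!natrM; congr _%:R.
  by rewrite mulnC mul_bin_diag mulnC.
rewrite -(mulr_natr _ 'C(m, i)) -(mulr_natr _ 'C(m.+1, i.+1)) -binE exprS.
by move: (5 ^+ _) ((-1) ^+ i) 'C(m, i)%:R i.+1%:R^-1 m.+1%:R => a b c d e; ring.
Qed.

End SignMatrix.

(** * Hard instances *)

(** The leaves partition the matrix into rectangles on which the answer, hence [P], is constant. *)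
Lemma W_protocol m h (A B O : Type) (a : {ffun 'I_m -> bool} -> A)
    (b : {ffun 'I_m -> bool} -> B) (P : O -> bool) (t : protocol A B O)
    (X Y : {set {ffun 'I_m -> bool}}) : m = h.*2 ->
  (\sum_(x in X) \sum_(y in Y) W x y *+ P (run t (a x) (b y))
     <= 20 ^+ h *+ leaves t)%R.
Proof.
move=> mE; elim: t X Y => [o|p t1 IH1 t2 IH2|q t1 IH1 t2 IH2] X Y /=.
- case: (P o); first exact: W_rectangle.
  by rewrite big1 ?exprn_ge0 // => x _; rewrite big1.
- rewrite (bigID (fun x => p (a x))) /= mulrnDr lerD //.
    apply: le_trans (IH1 [set x in X | p (a x)] Y).
    rewrite le_eqVlt; apply/orP; left; apply/eqP.
    by apply: eq_big => x; [rewrite inE|case/andP=> _ ->].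
  apply: le_trans (IH2 [set x in X | ~~ p (a x)] Y).
  rewrite le_eqVlt; apply/orP; left; apply/eqP.
  by apply: eq_big => x; [rewrite inE|case/andP=> _ /negbTE ->].
- under eq_bigr do rewrite (bigID (fun y => q (b y))) /=.
  rewrite big_split /= mulrnDr lerD //.
    apply: le_trans (IH1 X [set y in Y | q (b y)]).
    rewrite le_eqVlt; apply/orP; left; apply/eqP; apply: eq_bigr => x _.
    by apply: eq_big => y; [rewrite inE|case/andP=> _ ->].
  apply: le_trans (IH2 X [set y in Y | ~~ q (b y)]).
  rewrite le_eqVlt; apply/orP; left; apply/eqP; apply: eq_bigr => x _.
  by apply: eq_big => y; [rewrite inE|case/andP=> _ /negbTE ->].
Qed.

Section Instances.
Variables m f g : nat.
Local Notation bits := {ffun 'I_m -> bool}.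
Implicit Types (x y : bits) (i : 'I_m) (j : option 'I_m).

(* [inl (inl _)] is the planted pair. In block [i], [(i, None)] is always in
   the clique, which also contains [(i, Some (x i))]; Bob puts [(i, Some true)]
   into the class of [(i, None)] if [y i] and of [(i, Some false)] otherwise.
   The [inr (inl _)] are in the clique and only serve to reach size [n./2]; the
   [inr (inr _)] are never in it. *)
Definition label : finType := ((bool + 'I_m * option bool) + ('I_f.+1 + 'I_g))%type.
(** The parts of Bob's multipartite graph, one fewer than the size of Alice's clique. *)
Definition colour : finType := ((unit + 'I_m * bool) + 'I_f.+1)%type.
Implicit Types (s : label).

Definition in_clique x s : bool :=
  match s with
  | inl (inr (i, Some c)) => c == x i
  | inr (inr _) => false
  | _ => true
  end.

(** Labels never in the clique share the part [ord0], so at least one filler must exist. *)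
Definition colour_of y s : colour :=
  match s with
  | inl (inl _) => inl (inl tt)
  | inl (inr (i, None)) => inl (inr (i, true))
  | inl (inr (i, Some c)) => inl (inr (i, c && y i))
  | inr (inl l) => inr l
  | inr (inr _) => inr ord0
  end.

(** The pairs of labels that an answer can occupy; [active] tells which ones are available. *)
Definition spot j s : bool :=
  match j, s with
  | None, inl (inl _) => true
  | Some i, inl (inr (i', o)) => (i' == i) && (o != Some false)
  | _, _ => false
  end.

Definition active x y j : bool := if j is Some i then x i && y i else true.

Definition swap_fun i s : label :=
  match s with
  | inl (inl b) => inl (inr (i, if b then None else Some true))
  | inl (inr (i', None)) => if i' == i then inl (inl true) else s
  | inl (inr (i', Some true)) => if i' == i then inl (inl false) else s
  | _ => s
  end.

Lemma swap_funK i : involutive (swap_fun i).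
Proof.
case=> [[[]|[i' [[]|]]]|[l|l]] //=; rewrite ?eqxx //.
  by case: ifP => [/eqP->|/= ->].
by case: ifP => [/eqP->|/= ->].
Qed.

Definition swap i : {perm label} := perm (can_inj (swap_funK i)).

(** When [x i] holds, all four exchanged labels lie in the clique. *)
Lemma in_clique_swap x i s : x i -> in_clique x (swap i s) = in_clique x s.
Proof.
move=> xi; rewrite permE; case: s => [[[]|[i' [[]|]]]|[l|l]] //=; rewrite ?xi //.
  by case: eqP => //= ->; rewrite xi.
by case: eqP.
Qed.

(** The permutation of colours induced by [swap_fun] when [y i] holds; Bob's graph sees only
    equality of colours. *)
Definition swap_colour i (k : colour) : colour :=
  match k with
  | inl (inl _) => inl (inr (i, true))
  | inl (inr (i', true)) => if i' == i then inl (inl tt) else k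
  | _ => k
  end.

Lemma swap_colourK i : involutive (swap_colour i).
Proof.
case=> [[[]|[i' []]]|l] //=; rewrite ?eqxx //.
by case: ifP => [/eqP->|/= ->].
Qed.

Lemma colour_of_swap y i s :
  y i -> colour_of y (swap i s) = swap_colour i (colour_of y s).
Proof.
move=> yi; rewrite permE; case: s => [[[]|[i' [[]|]]]|[l|l]] //=; rewrite ?yi //.
  case: eqP => [->|/eqP ne_i] /=; rewrite ?yi ?eqxx //=.
  by case: (y i'); rewrite ?(negbTE ne_i).
by case: eqP.
Qed.

Lemma spot_swap i s : spot None (swap i s) = spot (Some i) s.
Proof.
by rewrite permE; case: s => [[[]|[i' [[]|]]]|[l|l]] //=; case: eqP; rewrite ?andbF.
Qed.

Lemma spot_inj j j' s : spot j s -> spot j' s -> j = j'.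
Proof.
by case: j j' s => [i|] [i'|] [[b|[i'' o]]|l] //= /andP[/eqP<- _] /andP[/eqP<- _].
Qed.

(** Fillers have colours of their own within the clique, and the two clique labels of block [i]
    share one only if [x i] and [y i] hold. *)
Lemma monochromatic_spot x y s s' : s != s' -> in_clique x s -> in_clique x s' ->
  colour_of y s = colour_of y s' ->
  exists2 j, active x y j & spot j s && spot j s'.
Proof.
case: s => [[b|[i [c|]]]|[l|l]] //; case: s' => [[b'|[i' [c'|]]]|[l'|l']] //=.
- by exists None.
- move=> ne /eqP cE /eqP c'E [ii' _]; subst i'.
  by rewrite cE c'E eqxx in ne.
- move=> _ /eqP cE _ [ii' ci]; subst i'.
  case/andP: ci => c1 yi; exists (Some i); rewrite /= ?eqxx ?c1 //.
  by rewrite -cE c1.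
- move=> _ _ /eqP cE [ii' ci]; subst i'.
  case/andP: (esym ci) => c1 yi; exists (Some i); rewrite /= ?eqxx ?c1 //.
  by rewrite -cE c1.
- by move=> ne _ _ [ii']; rewrite ii' eqxx in ne.
- by move=> ne _ _ [ii']; rewrite ii' eqxx in ne.
Qed.

Lemma card_label : #|label| = 2 + m * 3 + f.+1 + g.
Proof.
rewrite !card_sum card_prod card_option card_bool !card_ord; lia.
Qed.

Lemma card_colour : #|colour| = 1 + m * 2 + f.+1.
Proof. by rewrite !card_sum card_prod card_bool card_unit !card_ord. Qed.

Lemma card_in_clique x : #|[set s | in_clique x s]| = 2 + m * 2 + f.+1.
Proof.
have blocks : \sum_(q : 'I_m * option bool) in_clique x (inl (inr q)) = m * 2.
  transitivity (\sum_(i < m) \sum_(o : option bool) in_clique x (inl (inr (i, o)))).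
    by rewrite pair_bigA; apply: eq_bigr => -[].
  rewrite (eq_bigr (fun=> 2)) ?sum_nat_const ?card_ord // => i _.
  rewrite (bigD1 None) // (bigD1 (Some true)) // (bigD1 (Some false)) //=.
  by rewrite big1 => [|[[]|] //]; case: (x i).
transitivity (\sum_s in_clique x s).
  by rewrite -sum1_card big_mkcond; apply: eq_bigr => s _; rewrite inE; case: in_clique.
rewrite big_sumType /= !big_sumType /= blocks big_bool !sum_nat_const !card_ord.
by rewrite muln0 addn0 muln1.
Qed.

(** * Randomly relabelled graphs and the planted answer *)

Variables (n : nat) (iota : 'I_n -> label).
Hypothesis iota_bij : bijective iota.
Implicit Types (pi : {perm label}) (e : edge n).

Definition lab pi (v : 'I_n) : label := pi (iota v).

Lemma lab_bij pi : bijective (lab pi).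
Proof. exact: bij_comp (injF_bij (@perm_inj _ pi)) iota_bij. Qed.

Definition alice pi x : {ffun edge n -> bool} :=
  [ffun e : edge n => [forall v in val e, in_clique x (lab pi v)]].

Definition bob pi y : {ffun edge n -> bool} :=
  [ffun e : edge n => ~~ [forall u in val e, forall v in val e,
                   colour_of y (lab pi u) == colour_of y (lab pi v)]].

Lemma CLIQUE_alice pi x : CLIQUE n (2 + m * 2 + f.+1) (alice pi x).
Proof.
apply/existsP; exists [set v | in_clique x (lab pi v)].
rewrite -(card_in_clique x); apply/andP; split.
  have -> : [set v | in_clique x (lab pi v)] = lab pi @^-1: [set s | in_clique x s].
    by apply/setP=> v; rewrite !inE.
  by rewrite on_card_preimset //; apply: onW_bij (lab_bij pi).
apply/forallP=> e; apply/implyP=> /subsetP sub_e; rewrite ffunE.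
by apply/forall_inP=> v /sub_e; rewrite inE.
Qed.

(** Pigeonhole: a clique has at most one vertex of each colour. *)
Lemma CLIQUE_bob pi y : ~~ CLIQUE n (2 + m * 2 + f.+1) (bob pi y).
Proof.
apply/existsP=> -[S /andP[/eqP cardS /forallP cliqueS]].
have inj_S : {in S &, injective (fun v => colour_of y (lab pi v))}.
  move=> u v uS vS /= eq_uv; apply/eqP; apply: contraT => ne_uv.
  have e2 : #|[set u; v]| == 2 by rewrite cards2 ne_uv.
  have /implyP := cliqueS (Sub [set u; v] e2 : edge n).
  rewrite ffunE SubK subUset !sub1set uS vS => /(_ isT)/negP; case.
  apply/forall_inP=> a; rewrite !inE => /pred2P a_uv.
  apply/forall_inP=> b; rewrite !inE => /pred2P b_uv.
  by case: a_uv => ->; case: b_uv => ->; rewrite ?eq_uv.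
have := max_card (mem [set colour_of y (lab pi v) | v in S]).
by rewrite card_in_imset // cardS card_colour; lia.
Qed.

Variable t : protocol {ffun edge n -> bool} {ffun edge n -> bool} (edge n).
Hypothesis t_solves : solves t set0 (CLIQUE n (2 + m * 2 + f.+1)).

Definition answer pi x y := run t (alice pi x) (bob pi y).

Definition hits pi x y j := [forall v in val (answer pi x y), spot j (lab pi v)].

(** The answer lies inside the clique and inside one part, so it fills an active spot; spots are
    disjoint. *)
Lemma answer_unique_spot pi x y : \sum_(j | active x y j) hits pi x y j = 1.
Proof.
set e := answer pi x y.
have no_diff : {in set0, alice pi x =1 bob pi y} by move=> v; rewrite inE.
have := t_solves no_diff (CLIQUE_alice pi x) (CLIQUE_bob pi y).
rewrite -/(answer pi x y) -/e !ffunE negbK => /andP[/forall_inP in_e /forall_inP mono_e].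
have /cards2P[u [v [ne_uv eE]]] := valP e.
have ue : u \in val e by rewrite eE !inE eqxx.
have ve : v \in val e by rewrite eE !inE eqxx orbT.
have ne_lab : lab pi u != lab pi v by rewrite (inj_eq (bij_inj (lab_bij pi))).
have /forall_inP/(_ v ve)/eqP col_uv := mono_e u ue.
have [j act_j /andP[ju jv]] :=
  monochromatic_spot ne_lab (in_e u ue) (in_e v ve) col_uv.
rewrite (bigD1 j) //= big1 ?addn0.
  rewrite /hits -/e; case: forall_inP => // -[] a; rewrite eE !inE.
  by case/pred2P=> ->.
move=> j' /andP[_ ne_j]; rewrite /hits -/e; case: forall_inP => // /(_ u ue) j'u.
by rewrite (spot_inj j'u ju) eqxx in ne_j.
Qed.

Lemma hits_swap pi x y i : x i -> y i ->
  hits (pi * swap i)%g x y None = hits pi x y (Some i).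
Proof.
move=> xi yi.
have labM v : lab (pi * swap i)%g v = swap i (lab pi v) by rewrite /lab permM.
have -> : hits (pi * swap i)%g x y None =
    [forall v in val (answer pi x y), spot None (swap i (lab pi v))].
  rewrite /hits; have -> : answer (pi * swap i)%g x y = answer pi x y.
    congr (run t _ _); apply/ffunP=> e; rewrite !ffunE.
      by apply: eq_forallb_in => v _; rewrite labM in_clique_swap.
    congr (~~ _); apply: eq_forallb_in => u _; apply: eq_forallb_in => v _.
    by rewrite !labM !colour_of_swap // (inj_eq (inv_inj (swap_colourK i))).
  by apply: eq_forallb_in => v _; rewrite labM.
by apply: eq_forallb_in => v _; rewrite spot_swap.
Qed.

(* Exchanging the planted pair with an intersecting block of the two inputs
   leaves both graphs unchanged, so a uniformly random labelling makes the
   planted pair the answer with probability [1 / (1 + common x y)]. *)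
Lemma sum_hits_planted x y :
  (\sum_pi hits pi x y None) * (common x y).+1 = #|{perm label}|.
Proof.
rewrite -sum1_card; under [RHS]eq_bigr => pi _ do rewrite -(answer_unique_spot pi x y).
rewrite exchange_big /= (bigD1 None) //= mulnS; congr (_ + _).
rewrite [RHS](eq_bigr (fun=> \sum_pi hits pi x y None)); last first.
  case=> [i|] /=; last by [].
  rewrite andbT => /andP[xi yi].
  rewrite [RHS](reindex_inj (mulIg (swap i))).
  by apply: eq_bigr => pi _; rewrite hits_swap.
rewrite sum_nat_const mulnC; congr (_ * _).
rewrite /common -(card_imset _ (@Some_inj _)); apply: eq_card => -[i|].
  rewrite mem_imset; last exact: Some_inj.
  by rewrite inE [RHS]unfold_in /= andbT.
by rewrite [RHS]unfold_in /=; apply/imsetP=> -[].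
Qed.

Local Open Scope ring_scope.

(** Averaging over [pi] turns the planted hits into the weights 1/(1 + [common]), while every single
    [pi] obeys the rectangle bound. *)
Lemma leaves_lower_bound h : m = h.*2 ->
  (5 ^ h <= h.*2.+1 * leaves t * 4 ^ h)%N.
Proof.
move=> mE; pose N : rat := #|{perm label}|%:R.
have N_gt0 : 0 < N by rewrite ltr0n; apply/card_gt0P; exists 1%g.
have sumE : \sum_pi \sum_x \sum_y W x y *+ hits pi x y None =
    N * \sum_(x : bits) \sum_(y : bits) W x y / (common x y).+1%:R.
  rewrite exchange_big mulr_sumr; apply: eq_bigr => x _.
  rewrite exchange_big mulr_sumr; apply: eq_bigr => y _.
  have C_neq0 : (common x y).+1%:R != 0 :> rat by rewrite pnatr_eq0.
  apply: (mulIf C_neq0); rewrite -mulrA mulfVK // /N -(sum_hits_planted x y).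
  rewrite natrM natr_sum [RHS]mulrAC; congr (_ * _).
  by rewrite mulr_suml; apply: eq_bigr => pi _; rewrite mulr_natl.
have le_sum : N * \sum_(x : bits) \sum_(y : bits) W x y / (common x y).+1%:R
    <= N * (20 ^+ h *+ leaves t).
  rewrite -sumE /N mulr_natl -sumr_const; apply: ler_sum => pi _.
  have := W_protocol (alice pi) (bob pi)
    (fun e : edge n => [forall v in val e, spot None (lab pi v)]) t setT setT mE.
  by under eq_bigl do rewrite inE; under eq_bigr do under eq_bigl do rewrite inE.
rewrite ler_pM2l // sum_W_common ler_pdivrMr ?ltr0n // mE in le_sum.
(* Gives 5^(m+1) - 4^(m+1) >= 5^m. *)
have le_pow : (4 : rat) ^+ h.*2 <= 5 ^+ h.*2.
  by apply: lerXn2r; rewrite ?nnegrE ?ler0n ?ler_nat.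
have p5 : 0 < 5 ^+ h :> rat by rewrite exprn_gt0.
rewrite -(ler_nat rat) !natrM !natrX -(ler_pM2r p5).
have <- : 5 ^+ h.*2 = 5 ^+ h * 5 ^+ h :> rat by rewrite -addnn exprD.
have -> : h.*2.+1%:R * (leaves t)%:R * 4 ^+ h * 5 ^+ h =
    20 ^+ h * (leaves t)%:R * h.*2.+1%:R :> rat.
  have -> : 20 = 4 * 5 :> rat by lra.
  by rewrite exprMn; ring.
rewrite -mulr_natr !exprS in le_sum; lra.
Qed.

End Instances.

(** * The lower bound *)

Lemma CLIQUE_monotone_off n k (B : {set edge n}) : monotone_off B (CLIQUE n k).
Proof.
move=> x y le_xy _ /existsP[S /andP[cardS /forallP cliqueS]].
apply/existsP; exists S; rewrite cardS; apply/forallP=> e; apply/implyP=> eS.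
by apply: (implyP (le_xy e)); apply: (implyP (cliqueS e)).
Qed.

Lemma card_eq_bijection (T T' : finType) :
  #|T| = #|T'| -> exists f : T -> T', bijective f.
Proof.
move=> eqT; exists (enum_val \o cast_ord eqT \o enum_rank).
apply: (bij_comp _ (Bijective (@enum_rankK T) (@enum_valK T))).
apply: bij_comp; first exact: (Bijective (@enum_valK T') (@enum_rankK T')).
exact: (Bijective (cast_ordK eqT) (cast_ordKV eqT)).
Qed.

Lemma CLIQUE_protocol_leaves n h
    (t : protocol {ffun edge n -> bool} {ffun edge n -> bool} (edge n)) :
  4 * h + 3 <= n./2 -> solves t set0 (CLIQUE n n./2) ->
  5 ^ h <= h.*2.+1 * leaves t * 4 ^ h.
Proof.
(* With m = 2h, [f] brings the clique to size [n./2]; [g] then brings the number of labels to [n],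
   since the clique omits one label per block. *)
move=> le_h; set f := n./2 - 3 - 4 * h.
have kE : n./2 = 2 + h.*2 * 2 + f.+1 by rewrite /f; lia.
pose g := n - n./2 - h.*2.
have cardE : #|'I_n| = #|label h.*2 f g|.
  rewrite card_label card_ord /g; lia.
have [iota iota_bij] := card_eq_bijection cardE.
by rewrite kE => t_ok; apply: (leaves_lower_bound iota_bij t_ok).
Qed.

(** As 5^4 = 625 exceeds 2 * 4^4 = 512, (5/4)^(8j) is at least 2^(2j); one factor 2^j absorbs 16j +
    1. *)
Lemma pow5_bound j q :
  8 <= j -> 5 ^ (8 * j) <= (8 * j).*2.+1 * 2 ^ q * 4 ^ (8 * j) -> j <= q.
Proof.
move=> j_ge8 le_pow; rewrite leqNgt; apply/negP=> lt_q.
have lin_lt : (8 * j).*2.+1 <= 2 ^ j.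
  elim: j j_ge8 {le_pow lt_q} => // j IH; rewrite leq_eqVlt => /predU1P[<-//|lt_j].
  have := IH lt_j; rewrite expnS; lia.
have : 2 ^ (2 * j) * 4 ^ (8 * j) <= 5 ^ (8 * j).
  have -> : 8 * j = 4 * (2 * j) by lia.
  by rewrite (expnM 4) (expnM 5) -expnMn leq_exp2r //; lia.
apply/negP; rewrite -ltnNge; apply: leq_ltn_trans le_pow _.
have -> : 2 ^ (2 * j) = 2 ^ j * 2 ^ j by rewrite mul2n -addnn expnD.
rewrite ltn_pmul2r ?expn_gt0 //.
apply: (@leq_ltn_trans (2 ^ j * 2 ^ q)); first by rewrite leq_mul2r lin_lt orbT.
by rewrite ltn_pmul2l ?expn_gt0 // ltn_exp2l.
Qed.

Theorem theorem1 (C : forall n : nat, circuit (edge n)) (d w : nat -> nat)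
    (C_computes : forall (n : nat) (x : {ffun edge n -> bool}),
       circuit_fun (C n) x = CLIQUE n n./2 x)
    (C_depth : forall n : nat, has_depth (C n) (d n))
    (w_gt0 : forall n : nat, 0 < w n)
    (C_orient : forall n k : nat, k < size (gates (C n)) ->
       exists beta : {ffun edge n -> bool},
         has_orientation (gate_fun (C n) k) beta /\ weight beta <= w n) :
  exists c : rat, (0 < c)%R /\
    exists n0 : nat, forall n : nat, n0 <= n ->
      (c * n%:R <= (d n * w n)%:R)%R.
Proof.
suff [N [n0 [N_gt0 le_N]]] : exists N n0,
    0 < N /\ forall n, n0 <= n -> n <= N * (d n * w n).
  exists (N%:R^-1)%R; split; first by rewrite invr_gt0 ltr0n.
  by exists n0 => n /le_N; rewrite ler_pdivrMl ?ltr0n // -natrM ler_nat.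
(* Taking h = 8j in 4h + 3 <= n/2 explains 32. From n >= 1000 follow j >= 8 and n <= 64j + 69 <=
   128j, and 640 = 128 * 5. *)
exists 640, 1000; split=> // n n_ge.
pose j := (n./2 - 3) %/ 32.
suff: j <= 5 * w n * d n by rewrite /j; nia.
have /card_gt0P[v0 _] : 0 < #|edge n| by rewrite card_edge bin_gt0; lia.
have /andP[_ out_before] := circuit_wf (C n).
have f_mono : monotone_off set0 (wire_fun (C n) (output (C n))).
  move=> x y le_xy eq_xy; rewrite /wire_fun -!/(circuit_fun _ _) !C_computes.
  exact: (@CLIQUE_monotone_off n n./2 set0 x y le_xy eq_xy).
have [t le_t t_ok] :=
  circuit_protocol v0 (w_gt0 n) (C_orient n) out_before (C_depth n).2 f_mono.
have t_clique : solves t set0 (CLIQUE n n./2).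
  move=> x y eq_xy fx fy; apply: t_ok => //;
  by rewrite /wire_fun -/(circuit_fun _ _) C_computes.
apply: pow5_bound; first by rewrite /j; lia.
apply: leq_trans (CLIQUE_protocol_leaves _ t_clique) _; first by rewrite /j; lia.
by rewrite leq_mul2r leq_mul2l le_t !orbT.
Qed.
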